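(* Let $\theta\in\mathbb{R}$, $\Upsilon\subset M$, $\varphi\in\mathcal{C}^1(E,\mathbb{R})$, and let $$\Gamma:=\left\{\gamma\in\mathcal{C}([0,1],M):\gamma(0)\in\Upsilon,\ \varphi(\gamma(1))<\theta\right\}$$ be nonempty. Assume that $$a:=\inf_{\gamma\in\Gamma}\max_{t\in[0,1]}\varphi(\gamma(t))>b:=\sup_{\gamma\in\Gamma}\max\{\varphi(\gamma(0)),\varphi(\gamma(1))\}.$$ Then there exists a sequence $\{u_n\}\subset M$ satisfying $$\varphi(u_n)\to a,\qquad\left\|\varphi|_M'(u_n)\right\|\to0.$$
   Context: $H$ is a real Hilbert space with scalar product $(\cdot,\cdot)_H$ and norm $\|\cdot\|_H$, $E$ is a real Banach space with norm $\|\cdot\|_E$, both infinite dimensional, with continuous injections $E\hookrightarrow H\hookrightarrow E^*$ ($E^*$ the dual of $E$, $H$ identified with its dual). $M:=\{u\in E:\|u\|_H=1\}$ with the topology inherited from $E$; $T_uM=\{v\in E:(u,v)_H=0\}$ for $u\in M$. For $u\in M$, $\|\varphi|_M'(u)\|:=\sup\{|\langle\varphi'(u),v\rangle|:v\in T_uM,\ \|v\|_E=1\}$. *)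

(* Defs.v *)
From HB Require Import structures.
From mathcomp Require Import all_boot all_order all_algebra sesquilinear.
From mathcomp Require Import all_classical all_reals all_analysis.

Set Implicit Arguments.
Unset Strict Implicit.
Unset Printing Implicit Defensive.

Import Order.TTheory GRing.Theory Num.Theory.
Import numFieldNormedType.Exports.

Local Open Scope classical_set_scope.
Local Open Scope ring_scope.

Definition infinite_dimensional (R : realType) (V : lmodType R) : Prop :=
  ~ exists (n : nat) (e : 'I_n -> V),
      forall v : V, exists c : 'I_n -> R, v = \sum_(i < n) c i *: e i.

(* sup { |f v| : v in A, |v| = 1 } in [-oo, +oo].  For A = setT and f linear
   this is the norm of f in E^* (+oo if f is unbounded), provided E <> 0. *)
Definition norm_on (R : realType) (E : normedModType R) (A : set E)
    (f : E -> R) : \bar R :=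
  ereal_sup [set (`|f v|)%:E | v in [set v : E | A v /\ `|v| = 1]].

Definition dual_norm (R : realType) (E : normedModType R) (f : E -> R) : \bar R :=
  norm_on [set: E] f.

(* Continuity of a map F : T -> E^* for the norm of E^*, where each functional
   F x is given as a function E -> R. *)
Definition continuous_to_dual (R : realType) (T : topologicalType)
    (E : normedModType R) (F : T -> E -> R) : Prop :=
  forall x : T, dual_norm (fun v => F y v - F x v) @[y --> x] --> 0%E.

(* phi is Frechet differentiable everywhere and u |-> phi'(u) is continuous
   from E to E^*. *)
Definition C1 (R : realType) (E : normedModType R) (phi : E -> R) : Prop :=
  (forall u : E, differentiable phi u) /\
  continuous_to_dual (fun u : E => ('d phi u : E -> R)).

(* The pivot identification: h in H acts on E as v |-> (h, j v)_H, with
   j : E -> H the injection of E into H. *)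
Definition to_dual (R : realType) (E H : normedModType R)
    (dot : {dot H for idfun}) (j : E -> H) (h : H) : E -> R :=
  fun v => dot h (j v).

Section Constraint.
Variables (R : realType) (E H : normedModType R).
Variables (dot : {dot H for idfun}) (j : E -> H).

Definition sphereM : set E := [set u | `|j u| = 1].

Definition tangent (u : E) : set E := [set v | dot (j u) (j v) = 0].

(* The norm of the derivative of phi restricted to the sphere, at u. *)
Definition norm_dM (phi : E -> R) (u : E) : \bar R :=
  norm_on (tangent u) ('d phi u).

(* Paths are functions on R of which only the restriction to [0, 1] matters. *)
Definition GammaM (theta : R) (Upsilon : set E) (phi : E -> R) :
    set (R -> E) :=
  [set gam : R -> E | [/\ {within `[0 : R, 1], continuous gam},
                 forall t : R, t \in `[0, 1] -> sphereM (gam t),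
                 Upsilon (gam 0) & phi (gam 1) < theta]].

End Constraint.

(* The inner supremum is the maximum of phi along gam: it is attained, phi o gam
   being continuous on [0, 1].  Extended reals avoid the default value of the
   real-valued infimum and supremum on unbounded sets. *)
Definition minimax (R : realType) (E : normedModType R) (phi : E -> R)
    (Gamma : set (R -> E)) : \bar R :=
  ereal_inf
    [set ereal_sup [set (phi (gam t))%:E | t in `[0, 1]] | gam in Gamma].

Definition endpoint_sup (R : realType) (E : normedModType R) (phi : E -> R)
    (Gamma : set (R -> E)) : \bar R :=
  ereal_sup [set (Num.max (phi (gam 0)) (phi (gam 1)))%:E | gam in Gamma].

(* Main.v *)
Require Import Defs.
From mathcomp Require Import all_boot all_order all_algebra sesquilinear.
From mathcomp Require Import ring lra.
From mathcomp Require Import all_classical all_reals all_analysis.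

(** The theorem follows, with e = 1/(n+1), once every e > 0 admits a point u of
    the sphere with |phi u - a| < e and constrained slope at most e
    ([almost_critical_point]).
    Suppose that for some e the slope exceeds e at every point of the sphere
    with |phi - a| < e.  A contradiction comes from a complete order on paths,
    in place of the flow of a pseudo-gradient field.

    Fix a path g0 of Gamma with phi <= a + e/2 along it, and consider the pairs
    (g, m) of a path g with the endpoints of g0 and a real m >= phi along g;
    then m >= a by definition of the minimax value.  Order them by
      (g', m') below (g, m)  iff  (e/2) |g t - g' t| <= m - m' for all t.
    A decreasing sequence of such pairs is uniformly Cauchy because m is bounded
    below by a, so it has a lower bound, its limit ([controlled_sequence_limit]).
    The Brezis-Browder form of Ekeland's principle ([ordering_principle]) then
    yields a pair (g, m) below (g0, a + e/2) under which m cannot be decreased.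

    Yet it can be decreased ([deformation]).  Wherever phi (g t) = m the slope
    exceeds e, so there is a tangent direction along which phi decreases at rate
    more than e; the admissible directions at t form a convex set, and a
    partition of unity on [0, 1] turns local choices into a continuous field w
    of tangent vectors along g ([continuous_selection], [descent_field]).  It
    vanishes at the endpoints, where phi < a <= m: this is where the gap between
    a and the endpoint values is used.  Moving g t to the normalisation of
    g t + h w t moves it by at most 2 h and brings phi down to m - e h along the
    whole path, for some small h > 0 uniform in t by compactness of [0, 1].  The
    new path with m - e h is below (g, m), a contradiction. *)

Import Order.TTheory GRing.Theory Num.Theory.
Import numFieldNormedType.Exports.

Set Implicit Arguments.
Unset Strict Implicit.
Unset Printing Implicit Defensive.

Local Open Scope classical_set_scope.
Local Open Scope ring_scope.

(** * Minimal elements of a preorder *)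

(** Choose x_{n+1} below x_n with f x_{n+1} within 1/(n+1) of the infimum of f
    below x_n.  Whatever lies under a lower bound l of the sequence lies under
    every x_n, so f there is at least f l - 1/(n+1) for all n. *)
Lemma ordering_principle (R : realType) (T : Type) (le : T -> T -> Prop)
    (f : T -> R) (m : R) :
  (forall x, le x x) ->
  (forall y x z, le x y -> le y z -> le x z) ->
  (forall x y, le y x -> f y <= f x) ->
  (forall x, m <= f x) ->
  (forall u : nat -> T, (forall n, le (u n.+1) (u n)) ->
     exists l, forall n, le l (u n)) ->
  forall x0, exists2 x, le x x0 & forall y, le y x -> f x <= f y.
Proof.
move=> refl_le trans_le le_f f_ge chain x0.
have next (p : T * nat) : exists y, le y p.1 /\
    forall z, le z p.1 -> f y <= f z + p.2.+1%:R^-1.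
  case: p => x n /=.
  have Sinf : has_inf [set f z | z in [set z | le z x]].
    split; first by exists (f x), x => //; exact: refl_le.
    by exists m => _ [z _ <-]; exact: f_ge.
  have n0 : 0 < n.+1%:R^-1 :> R by rewrite invr_gt0.
  have [_ [y yx <-] fy] := inf_adherent n0 Sinf.
  exists y; split=> // z zx; apply/ltW/(lt_le_trans fy).
  rewrite lerD2r; apply: ge_inf; last by exists z.
  by case: Sinf.
have [g gP] := choice next.
pose fix u n := if n is k.+1 then g (u k, k) else x0.
have uS n : le (u n.+1) (u n) by have [] := gP (u n, n).
have [l lu] := chain u uS; exists l; first exact: (lu 0%N).
move=> y yl; apply/ler_addgt0Pr => e e0.
have [n _ /(_ n (leqnn n)) /= ne] := near_infty_natSinv_lt (PosNum e0).
have [_ /(_ y (trans_le _ _ _ yl (lu n)))] := gP (u n, n).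
move=> fS; apply: (le_trans (le_f _ _ (lu n.+1))).
by apply: (le_trans fS); rewrite lerD2l ltW.
Qed.

(** * Continuous selections *)

(** Summing pairs (w i, w i v i) in a convex cone avoids renormalising the
    weights at each step. *)
Lemma convex_weighted_mean (R : realFieldType) (V : lmodType R) (P : V -> Prop)
    (I : eqType) (s : seq I) (w : I -> R) (v : I -> V) :
  (forall x y l, P x -> P y -> 0 <= l <= 1 -> P (l *: x + (1 - l) *: y)) ->
  (forall i, 0 <= w i) -> (forall i, i \in s -> 0 < w i -> P (v i)) ->
  0 < \sum_(i <- s) w i ->
  P ((\sum_(i <- s) w i)^-1 *: \sum_(i <- s) w i *: v i).
Proof.
move=> cvxP w_ge0 wP.
(* [Q] is the convex cone over [{1} x P], with its apex. *)
pose Q (c : R) z := (c = 0 /\ z = 0) \/ (0 < c /\ P (c^-1 *: z)).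
suff : Q (\sum_(i <- s) w i) (\sum_(i <- s) w i *: v i).
  by move=> [[-> _]|[]//]; rewrite ltxx.
rewrite !big_seq; apply: big_ind2 => [|c x d y|i si]; first by left.
- case=> [[-> ->]|[c0 Px]]; first by rewrite !add0r.
  case=> [[-> ->]|[d0 Py]]; first by rewrite !addr0; right.
  have cd0 : 0 < c + d by rewrite addr_gt0.
  right; split=> //.
  have := cvxP _ _ (c / (c + d)) Px Py.
  rewrite !scalerA [c / _ * _]mulrAC divff ?gt_eqF// mul1r.
  have -> : (1 - c / (c + d)) * d^-1 = (c + d)^-1.
    by field; rewrite !gt_eqF.
  rewrite -scalerDr; apply.
  rewrite ler_pdivrMr// mul1r lerDl (ltW d0) andbT.
  by apply: divr_ge0; exact: ltW.
- have := w_ge0 i; rewrite le_eqVlt => /orP[/eqP <-|wi]; first by left; rewrite scale0r.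
  by right; split=> //; rewrite scalerA mulVf ?gt_eqF// scale1r; exact: wP.
Qed.

(** A local choice v s is valid on a ball of radius r s around s.  The tents
    t |-> max 0 (r s - |s - t|) over a finite subcover of K, once normalised,
    are a partition of unity, and averaging the v s with these weights stays
    inside the convex set [P t].  The sum of the tents may vanish outside K,
    which limits continuity to the points of K. *)
Lemma continuous_selection (R : realType) (T E : normedModType R) (K : set T)
    (P : T -> E -> Prop) :
  compact K ->
  (forall t x y l, P t x -> P t y -> 0 <= l <= 1 -> P t (l *: x + (1 - l) *: y)) ->
  (forall s, K s -> exists v, \forall t \near s, P t v) ->
  exists v : T -> E, forall t, K t -> {for t, continuous v} /\ P t (v t).
Proof.
move=> Kc cvxP locP.
have [[v r] /= vrP] : exists vr : (T -> E) * (T -> R),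
    forall s, K s -> 0 < vr.2 s /\ forall t, `|s - t| < vr.2 s -> P t (vr.1 s).
  suff /choice[g gP] : forall s, exists vr : E * R,
      K s -> 0 < vr.2 /\ forall t, `|s - t| < vr.2 -> P t vr.1.
    by exists (fun s => (g s).1, fun s => (g s).2).
  move=> s; have [Ks|nKs] := pselect (K s); last by exists (0, 0).
  have [v /nbhs_ballP[r r0 rP]] := locP s Ks.
  by exists (v, r) => _; split=> // t st; apply: rP; rewrite -ball_normE.
move: (Kc); rewrite compact_cover => /(_ _ K (fun s => ball s (r s))) [].
- by move=> s Ks; apply: ball_open; have [] := vrP s Ks.
- by move=> s Ks; exists s => //; apply: ballxx; have [] := vrP s Ks.
move=> D0 DK0 Kcov0; pose D : seq T := finmap.enum_fset D0.
have DK s : s \in D -> K s by move=> /DK0 /set_mem.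
have {}Kcov t : K t -> exists2 s, s \in D & ball s (r s) t.
  by move=> /Kcov0[s sD st]; exists s.
pose w s t := Num.max 0 (r s - `|s - t|).
have w_ge0 s t : 0 <= w s t by rewrite le_max lexx.
have w_gt0 s t : (0 < w s t) = (`|s - t| < r s).
  by rewrite lt_max ltxx subr_gt0.
have w_cont s : continuous (w s).
  move=> t; apply: (@continuous_max _ _ (cst 0) (fun t => r s - `|s - t|)).
    exact: cvg_cst.
  apply: cvgB; first exact: cvg_cst.
  by apply: cvg_norm; apply: cvgB; [exact: cvg_cst|exact: cvg_id].
have W_gt0 t : K t -> 0 < \sum_(s <- D) w s t.
  move=> Kt; have [s sD st] := Kcov t Kt.
  rewrite (big_rem s)//= ltr_pwDl ?sumr_ge0// w_gt0.
  by move: st; rewrite -ball_normE.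
exists (fun t => (\sum_(s <- D) w s t)^-1 *: \sum_(s <- D) w s t *: v s).
move=> t Kt; split.
  apply: cvgZ.
    apply: cvgV; first by rewrite gt_eqF ?W_gt0.
    by apply: cvg_big => [|s _]; [exact: add_continuous|exact: w_cont].
  apply: cvg_big => [|s _]; first exact: add_continuous.
  by apply: cvgZr_tmp; exact: w_cont.
apply: convex_weighted_mean (W_gt0 t Kt) => //; first exact: cvxP.
move=> s sD; rewrite w_gt0 => st.
by have [|_] := vrP s; [exact: DK|exact].
Qed.

(** * The scalar product *)

Section ScalarProduct.
Context {R : realType} {H : normedModType R} (dot : {dot H for idfun}).
Context (norm_dot : forall x : H, `|x| = Num.sqrt (dot x x)).

Lemma dotC (x y : H) : dot x y = dot y x.
Proof. by rewrite hermC expr0 mul1r. Qed.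

Lemma dotDr (x y z : H) : dot x (y + z) = dot x y + dot x z.
Proof. by rewrite linearDr. Qed.

Lemma dotZr (x y : H) c : dot x (c *: y) = c * dot x y.
Proof. by rewrite linearZr. Qed.

Lemma dot0r (x : H) : dot x 0 = 0.
Proof. by rewrite -(scale0r (0 : H)) dotZr mul0r. Qed.

Lemma dotxx (x : H) : dot x x = `|x| ^+ 2.
Proof.
rewrite norm_dot sqr_sqrtr//.
have [->|x0] := eqVneq x 0; first by rewrite dot0r.
by apply: ltW; apply: neq0_dnorm_gt0.
Qed.

Lemma sqr_normD (x y : H) :
  `|x + y| ^+ 2 = `|x| ^+ 2 + dot x y *+ 2 + `|y| ^+ 2.
Proof.
rewrite -!dotxx dotDr (dotC (x + y) x) (dotC (x + y) y).
by rewrite !dotDr (dotC y x) mulr2n; ring.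
Qed.

Lemma polarization (x y : H) :
  dot x y = (`|x + y| ^+ 2 - `|x| ^+ 2 - `|y| ^+ 2) / 2.
Proof. by rewrite sqr_normD mulr2n; field. Qed.

(** Polarization writes the scalar product through norms, whose continuity is
    known. *)
Lemma cvg_dot (I : Type) (F : set_system I) (FF : Filter F)
    (f g : I -> H) (x y : H) :
  f @ F --> x -> g @ F --> y -> dot (f i) (g i) @[i --> F] --> dot x y.
Proof.
move=> fx gy; under eq_cvg do rewrite polarization.
rewrite polarization.
have sqr h z : h @ F --> z -> `|h i| ^+ 2 @[i --> F] --> `|z : H| ^+ 2.
  by move=> hz; under eq_cvg do rewrite expr2; rewrite expr2; apply: cvgM; apply: cvg_norm.
apply: cvgMr_tmp; apply: cvgB; last exact: sqr.
by apply: cvgB; apply: sqr => //; apply: cvgD.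
Qed.

End ScalarProduct.

(** * Continuously differentiable functions *)

Lemma dual_norm_ltP (R : realType) (E : normedModType R) (f : E -> R) (e : R) :
  (forall c v, f (c *: v) = c * f v) -> (dual_norm f < e%:E)%E ->
  forall v, `|f v| <= e * `|v|.
Proof.
move=> fZ fe v; have [->|v0] := eqVneq v 0.
  by rewrite -(scale0r (0 : E)) fZ mul0r scale0r !normr0 mulr0.
have nv0 : 0 < `|v| by rewrite normr_gt0.
rewrite -ler_pdivrMr// mulrC -{1}(ger0_norm (ltW nv0)) -normfV -normrM -fZ.
rewrite -lee_fin; apply: le_trans (ltW fe); apply: ereal_sup_ubound.
by exists (`|v|^-1 *: v) => //; split=> //; rewrite normrZ normfV normr_id mulVf ?gt_eqF.
Qed.

(** Joint continuity of (x, w) |-> phi'(x) w: the norm continuity of phi' makes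
    phi'(f i) w - phi'(x) w small uniformly over bounded w. *)
Lemma cvg_diff (R : realType) (E : normedModType R) (phi : E -> R)
    (I : Type) (F : set_system I) (FF : Filter F) (f g : I -> E) (x w : E) :
  C1 phi -> f @ F --> x -> g @ F --> w ->
  'd phi (f i) (g i) @[i --> F] --> 'd phi x w.
Proof.
move=> [dphi cphi] fx gw.
have -> : 'd phi x w = 0 + 'd phi x w by rewrite add0r.
have dE i : 'd phi (f i) (g i) =
    ('d phi (f i) (g i) - 'd phi x (g i)) + 'd phi x (g i) by rewrite subrK.
under eq_cvg do rewrite dE.
apply: cvgD; last first.
  have dc : {for w, continuous ('d phi x : E -> R)} by exact: diff_continuous.
  exact: (continuous_cvg _ dc gw).
apply/cvgr0Pnorm_le => e e0.
have w1 : 0 < `|w| + 1 by rewrite ltr_wpDl.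
pose d := e / (`|w| + 1); have d0 : 0 < d by rewrite divr_gt0.
have nx : \forall y \near x, (dual_norm (fun v => 'd phi y v - 'd phi x v)%R < d%:E)%E.
  apply: (cphi x [set z | (z < d%:E)%E]); apply: open_ereal_lt'.
  by rewrite lte_fin.
have := fx _ nx => nf.
have nw : \forall i \near F, `|g i| < `|w| + 1.
  by apply: (cvgr_lt `|w|); [exact: cvg_norm|rewrite ltrDl].
near=> i.
have : `|'d phi (f i) (g i) - 'd phi x (g i)| <= d * `|g i|.
  apply: (dual_norm_ltP (f := fun v => 'd phi (f i) v - 'd phi x v)).
    move=> c v; have dZ y : 'd phi y (c *: v) = c * 'd phi y v by exact: linearZ.
    by rewrite !dZ mulrBr.
  by near: i.
move=> /le_trans; apply; rewrite /d mulrAC ler_pdivrMr// ler_pM2l//.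
by apply: ltW; near: i.
Unshelve. all: by end_near. Qed.

Lemma mean_value_ray (R : realType) (E : normedModType R) (phi : E -> R)
    (x w : E) (h : R) :
  (forall u, differentiable phi u) -> 0 < h ->
  exists2 r, 0 < r < h & phi (x + h *: w) - phi x = 'd phi (x + r *: w) w * h.
Proof.
move=> dphi h0.
have dr (r : R) : is_derive r 1 (fun r => phi (x + r *: w)) ('d phi (x + r *: w) w).
  have dl : is_diff r (cst x + *:%R ^~ w) (0 + *:%R ^~ w) by exact: is_diffD.
  have dp : is_diff ((cst x + *:%R ^~ w) r) phi ('d phi (x + r *: w)).
    exact: differentiableP.
  have dc := is_diff_comp dl dp.
  have /derivable1_diffP dv : differentiable (phi \o (cst x + *:%R ^~ w)) r.
    by case: dc.
  apply: DeriveDef; first exact: dv.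
  rewrite deriveE; last by case: dc.
  by rewrite diff_val /= fctE add0r scale1r.
have [|r] := @MVT R (fun r => phi (x + r *: w)) (fun r => 'd phi (x + r *: w) w)
  0 h h0 (fun r _ => dr r).
  apply: continuous_subspaceT => r; apply: differentiable_continuous.
  by apply/derivable1_diffP; case: (dr r).
by rewrite in_itv subr0 scale0r addr0 => rh ?; exists r.
Qed.

(** * Geometry of the sphere *)

Section Sphere.
Context {R : realType} {E H : normedModType R} (dot : {dot H for idfun}).
Context (norm_dot : forall x : H, `|x| = Num.sqrt (dot x x)).
Context (j : {linear E -> H}) (j_cont : continuous j).

Definition tangent_proj (u v : E) : E := v - dot (j u) (j v) *: u.

Lemma tangent_tangent_proj (u v : E) :
  sphereM j u -> tangent dot j u (tangent_proj u v).
Proof.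
move=> ju; rewrite /tangent /tangent_proj /= linearB linearZ/= -scaleNr dotDr dotZr.
by rewrite (dotxx norm_dot) ju expr1n mulr1 subrr.
Qed.

Lemma tangent_proj_id (u v : E) :
  tangent dot j u v -> tangent_proj u v = v.
Proof. by rewrite /tangent_proj => ->; rewrite scale0r subr0. Qed.

Lemma tangent_proj0 (u : E) : tangent_proj u 0 = 0.
Proof. by rewrite /tangent_proj linear0 dot0r scale0r subr0. Qed.

Lemma tangent_proj_comb (u x y : E) (a b : R) :
  tangent_proj u (a *: x + b *: y) =
  a *: tangent_proj u x + b *: tangent_proj u y.
Proof.
rewrite /tangent_proj.
have -> : dot (j u) (j (a *: x + b *: y)) =
    a * dot (j u) (j x) + b * dot (j u) (j y).
  by rewrite linearD !linearZ/= dotDr !dotZr.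
rewrite scalerDl !scalerBr !scalerA.
by rewrite opprD addrACA.
Qed.

Lemma cvg_tangent_proj (I : Type) (F : set_system I) (FF : Filter F) (f g : I -> E) (x y : E) :
  f @ F --> x -> g @ F --> y ->
  tangent_proj (f i) (g i) @[i --> F] --> tangent_proj x y.
Proof.
move=> fx gy; apply: cvgB => //; apply: cvgZ => //.
by apply: (cvg_dot norm_dot); apply: continuous_cvg => //; exact: j_cont.
Qed.

(** The difference quotient at x of h |-> (x + h w) / |j (x + h w)| when w is
    tangent at x on the sphere, rearranged so that it makes sense, and is
    continuous, at h = 0, where its value is w.  The rearrangement uses
    q^2 = 1 + h^2 |j w|^2 for q = |j (x + h w)|, whence
    1 - 1/q = h^2 |j w|^2 / (q (q + 1)). *)
Definition radial_slope (x w : E) (h : R) : E :=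
  let q := `|j (x + h *: w)| in
  w - (h * `|j w| ^+ 2 / (q * (q + 1))) *: (x + h *: w).

(** x + h (radial_slope x w h) is the normalisation of x + h w. *)
Lemma radial_slope_sphere (x w : E) (h : R) :
  sphereM j x -> tangent dot j x w ->
  sphereM j (x + h *: radial_slope x w h).
Proof.
rewrite /sphereM /tangent /= => jx xw.
set q := `|j (x + h *: w)|.
have q2 : q ^+ 2 = 1 + h ^+ 2 * `|j w| ^+ 2.
  rewrite /q linearD linearZ/= (sqr_normD norm_dot) jx dotZr xw mulr0 mul0rn.
  by rewrite addr0 expr1n normrZ exprMn real_normK ?num_real.
have q0 : q != 0.
  apply/eqP => q0; move: q2; rewrite q0 expr0n/= => /eqP.
  by rewrite lt_eqF// ltr_pwDl// mulr_ge0 ?sqr_ge0.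
have q10 : q + 1 != 0 by rewrite gt_eqF// ltr_wpDl ?normr_ge0.
have -> : x + h *: radial_slope x w h = q^-1 *: (x + h *: w).
  rewrite /radial_slope -/q scalerBr addrA scalerA -[X in X - _]scale1r -scalerBl.
  congr (_ *: _).
  have -> : h * (h * `|j w| ^+ 2 / (q * (q + 1))) = (q ^+ 2 - 1) / (q * (q + 1)).
    by rewrite q2; ring.
  by field; rewrite q0.
by rewrite linearZ/= normrZ normfV normr_id mulVf.
Qed.

Lemma cvg_radial_slope (I : Type) (F : set_system I) (FF : Filter F)
    (f g : I -> E) (c : I -> R) (x w : E) (h : R) :
  sphereM j x -> tangent dot j x w ->
  f @ F --> x -> g @ F --> w -> c @ F --> h ->
  radial_slope (f i) (g i) (c i) @[i --> F] --> radial_slope x w h.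
Proof.
rewrite /sphereM /tangent /= => jx xw fx gw ch.
have fcg : f i + c i *: g i @[i --> F] --> x + h *: w.
  by apply: cvgD => //; exact: cvgZ.
have cj k z : k @ F --> z -> `|j (k i)| @[i --> F] --> `|j z|.
  by move=> kz; apply: cvg_norm; apply: continuous_cvg => //; exact: j_cont.
have q0 : 0 < `|j (x + h *: w)|.
  rewrite normr_gt0; apply/eqP => j0.
  have := sqr_normD norm_dot (j x) (j (h *: w)).
  rewrite -linearD j0 normr0 expr0n/= jx linearZ/= dotZr xw mulr0 mul0rn addr0 expr1n.
  by move/eqP; rewrite lt_eqF// ltr_pwDl// sqr_ge0.
apply: cvgB => //; apply: cvgZ => //; apply: cvgM.
  by apply: cvgM => //; apply: cvgM; exact: cj.
apply: cvgV; first by rewrite mulf_neq0 ?gt_eqF// addr_gt0.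
by apply: cvgM; [exact: cj|apply: cvgD; [exact: cj|exact: cvg_cst]].
Qed.

(** * Deformation of a path along a descent field *)

Lemma descent_direction (phi : E -> R) (u : E) (e : R) :
  (e%:E < norm_dM dot j phi u)%E ->
  exists v, [/\ tangent dot j u v, `|v| = 1 & 'd phi u v < - e].
Proof.
move=> /ereal_sup_gt[_ [v [uv v1] <-]]; rewrite lte_fin ltr_normr.
case/orP => ev.
  have dN : 'd phi u (- v) = - 'd phi u v by exact: linearN.
  exists (- v); split; [|by rewrite normrN|by rewrite dN ltrN2].
  by rewrite /tangent /= linearN -scaleN1r dotZr uv mulr0.
by exists v; split=> //; rewrite ltrNr.
Qed.

(** The requirements on w t are imposed on the tangential part of an arbitrary
    vector, which makes them convex in that vector and open in t, as
    [continuous_selection] asks.  At t = s a descent direction of norm 1 is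
    chosen if phi (gam s) >= m, and 0 otherwise. *)
Lemma descent_field (T : normedModType R) (phi : E -> R) (phi_C1 : C1 phi)
    (K : set T) (gam : T -> E) (b m e : R) :
  compact K -> continuous gam -> (forall t, sphereM j (gam t)) -> b < m ->
  (forall t, K t -> m <= phi (gam t) -> (e%:E < norm_dM dot j phi (gam t))%E) ->
  exists w : T -> E, forall t, K t ->
    [/\ {for t, continuous w},
        tangent dot j (gam t) (w t),
        `|w t| < 2,
        m <= phi (gam t) -> 'd phi (gam t) (w t) < - e &
        phi (gam t) <= b -> w t = 0].
Proof.
move=> Kc gam_cont gamM bm slope.
have phi_cont : continuous phi.
  by move=> x; apply: differentiable_continuous; case: phi_C1.
have phigam t : phi (gam t') @[t' --> t] --> phi (gam t).
  by apply: continuous_cvg; [exact: phi_cont|exact: gam_cont].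
pose p t v := tangent_proj (gam t) v.
have p_cvg t v : p t' v @[t' --> t] --> p t v.
  by apply: cvg_tangent_proj => //; [exact: gam_cont|exact: cvg_cst].
pose P t v := [/\ `|p t v| < 2,
  m <= phi (gam t) -> 'd phi (gam t) (p t v) < - e & phi (gam t) <= b -> v = 0].
have cvxP t x y l : P t x -> P t y -> 0 <= l <= 1 -> P t (l *: x + (1 - l) *: y).
  move=> [x2 xm xb] [y2 ym yb] /andP[l0 l1].
  have l1' : 0 <= 1 - l by rewrite subr_ge0.
  have cvx (c d k : R) : c < k -> d < k -> l * c + (1 - l) * d < k.
    move=> ck dk; apply: (@le_lt_trans _ _ (Num.max c d)); last by rewrite gt_max ck.
    have lc : l * c <= l * Num.max c d by rewrite ler_wpM2l// le_max lexx.
    have ld : (1 - l) * d <= (1 - l) * Num.max c d.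
      by rewrite ler_wpM2l// le_max lexx orbT.
    by apply: (le_trans (lerD lc ld)); rewrite -mulrDl addrC subrK mul1r.
  split.
  - rewrite /p tangent_proj_comb; apply: (le_lt_trans (ler_normD _ _)).
    by rewrite !normrZ (ger0_norm l0) (ger0_norm l1'); exact: cvx.
  - move=> mt; rewrite /p tangent_proj_comb.
    have -> : 'd phi (gam t) (l *: p t x + (1 - l) *: p t y) =
        l * 'd phi (gam t) (p t x) + (1 - l) * 'd phi (gam t) (p t y).
      by rewrite linearD; congr (_ + _); exact: linearZ.
    by apply: cvx; [exact: xm|exact: ym].
  - by move=> tb; rewrite xb// yb// !scaler0 addr0.
have locP s : K s -> exists v, \forall t \near s, P t v.
  move=> Ks; have [ms|sm] := leP m (phi (gam s)); last first.
    exists 0; near=> t.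
    have tm : phi (gam t) < m by near: t; apply: (cvgr_lt (phi (gam s))); [exact: phigam|].
    have p0 : p t 0 = 0 by exact: tangent_proj0.
    by split=> //; [rewrite p0 normr0|rewrite leNgt tm].
  have [v [tv v1 dv]] := descent_direction (slope s Ks ms).
  exists v; near=> t; split.
  - near: t; apply: (cvgr_lt `|p s v|); first by apply: cvg_norm; exact: p_cvg.
    by rewrite /p tangent_proj_id// v1 ltr1n.
  - move=> _; near: t; apply: (cvgr_lt ('d phi (gam s) (p s v))).
      by apply: cvg_diff => //; [exact: gam_cont|exact: p_cvg].
    by rewrite /p tangent_proj_id.
  - suff bt : b < phi (gam t) by rewrite leNgt bt.
    by near: t; apply: (cvgr_gt (phi (gam s))); [exact: phigam|exact: lt_le_trans ms].
have [v vP] := continuous_selection Kc cvxP locP.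
exists (fun t => p t (v t)) => t Kt; have [v_cont [v2 vm vb]] := vP t Kt.
split=> //; first by apply: cvg_tangent_proj => //; exact: gam_cont.
- exact: tangent_tangent_proj.
- by move=> /vb ->; exact: tangent_proj0.
Unshelve. all: by end_near. Qed.

(** Each estimate holds for (t, h) near (s, 0+) by joint continuity, hence for
    all t in K with a common h > 0 since K is compact. *)
Lemma deformation (T : normedModType R) (phi : E -> R) (phi_C1 : C1 phi)
    (K : set T) (gam : T -> E) (b m e : R) :
  compact K -> continuous gam -> (forall t, sphereM j (gam t)) -> b < m -> 0 < e ->
  (forall t, K t -> phi (gam t) <= m) ->
  (forall t, K t -> m <= phi (gam t) -> (e%:E < norm_dM dot j phi (gam t))%E) ->
  exists (h : R) (eta : T -> E), 0 < h /\ forall t, K t ->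
    [/\ {for t, continuous eta}, sphereM j (eta t),
        `|gam t - eta t| <= 2 * h, phi (eta t) <= m - e * h &
        phi (gam t) <= b -> eta t = gam t].
Proof.
move=> Kc gam_cont gamM bm e0 phi_le slope.
have phi_cont : continuous phi.
  by move=> x; apply: differentiable_continuous; case: phi_C1.
have [w wP] := descent_field phi_C1 Kc gam_cont gamM bm slope.
pose xi t h := radial_slope (gam t) (w t) h.
have xi_cvg t : K t ->
    xi z.1 z.2 @[z --> filter_prod (nbhs t) (0^'+)] --> w t.
  move=> Kt; have [w_cont tw _ _ _] := wP t Kt.
  have Ft : z.1 @[z --> filter_prod (nbhs t) (0 : R)^'+] --> t by exact: cvg_fst.
  have -> : w t = radial_slope (gam t) (w t) 0.
    by rewrite /radial_slope mul0r mul0r scale0r subr0.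
  apply: cvg_radial_slope => //.
  - exact: (cvg_comp _ _ Ft (gam_cont t)).
  - exact: (cvg_comp _ _ Ft w_cont).
  - apply: cvg_trans (cvg_at_right_filter cvg_id); exact: cvg_snd.
pose Q h t := `|xi t h| <= 2 /\ phi (gam t + h *: xi t h) <= m - e * h.
have : \forall h \near 0^'+, K `<=` Q h.
  move/compact_near_coveringP/near_covering_withinP : (Kc); apply => s Ks.
  have [_ _ w2 dw _] := wP s Ks.
  pose F := filter_prod (nbhs s) (0 : R)^'+.
  have Ft : z.1 @[z --> F] --> s by exact: cvg_fst.
  have Fh : z.2 @[z --> F] --> (0 : R).
    by apply: cvg_trans (cvg_at_right_filter cvg_id); exact: cvg_snd.
  have Fgam : gam z.1 @[z --> F] --> gam s by exact: (cvg_comp _ _ Ft (gam_cont s)).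
  have Fxi : xi z.1 z.2 @[z --> F] --> w s by exact: xi_cvg.
  have Fh0 : \forall z \near F, 0 < z.2.
    have Fh' : z.2 @[z --> F] --> (0 : R)^'+ by exact: cvg_snd.
    exact: (Fh' _ (nbhs_right_gt 0)).
  have F2 : \forall z \near F, `|xi z.1 z.2| < 2.
    by apply: (cvgr_lt `|w s|) => //; exact: cvg_norm.
  suff : \forall z \near F, K z.1 -> Q z.2 z.1 by [].
  have [ms|sm] := leP m (phi (gam s)).
    (* Along the segment from [gam t] to its image, the derivative in the
       direction of the motion stays below [- e]: the mean value theorem
       gives the decrease. *)
    have [d d0 dP] : exists2 d, 0 < d & forall y v,
        `|gam s - y| < d -> `|w s - v| < d -> 'd phi y v < - e.
      have : nbhs (gam s, w s) [set z : E * E | 'd phi (z.1) z.2 < - e].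
        have cd : 'd phi (z.1) z.2 @[z --> nbhs (gam s, w s)] -->
            'd phi (gam s) (w s).
          by apply: cvg_diff => //; [exact: cvg_fst|exact: cvg_snd].
        exact: (cvgr_lt _ cd _ (dw ms)).
      move=> /nbhs_ballP[d d0 dP]; exists d => // y v ys vs.
      by apply: (dP (y, v)); split; rewrite -ball_normE.
    near=> z => Kz.
    have h0 : 0 < z.2 by near: z.
    have xi2 : `|xi z.1 z.2| < 2 by near: z.
    split; first exact: ltW.
    have [||r /andP[r0 rh]] := @mean_value_ray _ _ phi (gam z.1) (xi z.1 z.2) z.2.
    - by case: phi_C1.
    - by [].
    have lt_e : 'd phi (gam z.1 + r *: xi z.1 z.2) (xi z.1 z.2) < - e.
      apply: dP; last first.
        by near: z; apply: cvgr_dist_lt.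
      rewrite opprD addrA; apply: (le_lt_trans (ler_normB _ _)).
      have gd : `|gam s - gam z.1| < d / 2.
        by near: z; apply: cvgr_dist_lt => //; rewrite divr_gt0.
      have hd : z.2 < d / 4.
        by near: z; apply: (cvgr_lt (0 : R)) => //; rewrite divr_gt0.
      rewrite normrZ gtr0_norm//.
      have : r * `|xi z.1 z.2| <= z.2 * 2 by apply: ler_pM => //; exact: ltW.
      lra.
    have := phi_le z.1 Kz; nra.
  (* Away from the level [m], continuity leaves room for [e * h]. *)
  near=> z => _.
  have h0 : 0 < z.2 by near: z.
  split; first by apply: ltW; near: z.
  pose c := (phi (gam s) + m) / 2.
  have eh : e * z.2 < m - c.
    near: z; apply: (cvgr_lt (e * 0)); last by rewrite mulr0 /c; lra.
    by apply: cvgMl_tmp.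
  suff : phi (gam z.1 + z.2 *: xi z.1 z.2) < c by lra.
  near: z; apply: (cvgr_lt (phi (gam s))); last by rewrite /c; lra.
  apply: continuous_cvg; first exact: phi_cont.
  have -> : gam s = gam s + 0 *: w s by rewrite scale0r addr0.
  by apply: cvgD => //; exact: cvgZ.
move=> KQ.
have [h h0 hQ] : exists2 h, 0 < h & K `<=` Q h.
  near (0 : R)^'+ => h; exists h; first by near: h; exact: nbhs_right_gt.
  by near: h.
exists h, (fun t => gam t + h *: xi t h); split=> // t Kt.
have [xi2 phih] := hQ t Kt; have [w_cont tw _ _ wb] := wP t Kt.
split=> //.
- apply: cvgD; first exact: gam_cont.
  apply: cvgZ; first exact: cvg_cst.
  by apply: cvg_radial_slope => //; [exact: gam_cont|exact: cvg_cst].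
- exact: radial_slope_sphere.
- by rewrite opprD addrA subrr add0r normrN normrZ gtr0_norm// mulrC ler_wpM2r// ltW.
- move=> /wb w0; rewrite /xi /radial_slope w0 linear0 normr0 expr0n/= mulr0 mul0r.
  by rewrite scale0r subr0 scaler0 addr0.
Unshelve. all: by end_near. Qed.

End Sphere.

(** * Limits of paths *)

Lemma uniform_cvg_within_continuous (R : realType) (T : topologicalType)
    (E : normedModType R) (K : set T) (u : nat -> T -> E) (g : T -> E) :
  (forall n, {within K, continuous (u n)}) ->
  (forall e, 0 < e -> \forall n \near \oo, forall t, K t -> `|g t - u n t| < e) ->
  {within K, continuous g}.
Proof.
move=> uc ug; apply: (@uniform_limit_continuous_subspace _ _ _ (u @ \oo)).
  by near_simpl; apply: nearW => n; exact: uc.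
move=> P /uniform_nbhs[A [entA AP]].
move: entA; rewrite -entourage_ballE => -[e /= e0 eA].
near=> n; apply: AP => t Kt; apply: eA; rewrite /= -ball_normE /=.
by move: t Kt; near: n; exact: ug.
Unshelve. all: by end_near. Qed.

(** Telescoping, k |u_n t - u_p t| <= m_n - m_p for n <= p, and m converges: the
    sequence is Cauchy uniformly on K. *)
Lemma controlled_sequence_limit (R : realType) (T : topologicalType)
    (E : completeNormedModType R) (K : set T) (u : nat -> T -> E)
    (m : nat -> R) (k a : R) :
  0 < k -> (forall n, a <= m n) -> (forall n, m n.+1 <= m n) ->
  (forall n, {within K, continuous (u n)}) ->
  (forall n t, K t -> k * `|u n t - u n.+1 t| <= m n - m n.+1) ->
  exists (g : T -> E) (l : R),
    [/\ {within K, continuous g}, m @ \oo --> l,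
        forall t, K t -> u ^~ t @ \oo --> g t &
        forall n t, K t -> k * `|u n t - g t| <= m n - l].
Proof.
move=> k0 am mS uc um.
have m_cvg : cvgn m.
  apply: nonincreasing_is_cvgn; first exact/nonincreasing_seqP.
  by exists a => _ [n _ <-].
have step n p t : K t -> k * `|u n t - u (n + p)%N t| <= m n - m (n + p)%N.
  move=> Kt; elim: p => [|p IH]; first by rewrite addn0 !subrr normr0 mulr0.
  rewrite addnS; have := um (n + p)%N t Kt.
  have := ler_distD (u (n + p)%N t) (u n t) (u (n + p).+1 t).
  by move=> /(ler_wpM2l (ltW k0)); rewrite mulrDr; lra.
have lim_le n : limn m <= m n.
  by apply: nonincreasing_cvgn_ge => //; exact/nonincreasing_seqP.
have u_cvg t : K t -> cvgn (u ^~ t).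
  move=> Kt; apply/cauchy_cvgP/cauchy_exP => e e0.
  have [N _ NP] : \forall n \near \oo, m n < limn m + k * e.
    by apply: (cvgr_lt _ m_cvg); rewrite ltrDl mulr_gt0.
  exists (u N t); exists N => // n /= Nn; rewrite -ball_normE /=.
  rewrite -(subnKC Nn) -(ltr_pM2l k0); apply: (le_lt_trans (step _ _ _ Kt)).
  by have := NP N (leqnn N); have := lim_le (N + (n - N))%N; rewrite /=; lra.
pose g t := limn (u ^~ t).
have g_le n t : K t -> k * `|u n t - g t| <= m n - limn m.
  move=> Kt.
  have l1 : k * `|u n t - u p t| @[p --> \oo] --> k * `|u n t - g t|.
    apply: cvgMl_tmp; apply: cvg_norm; apply: cvgB; [exact: cvg_cst|exact: u_cvg].
  have l2 : m n - m p @[p --> \oo] --> m n - limn m.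
    by apply: cvgB => //; exact: cvg_cst.
  apply: (ler_cvg_to l1 l2); near=> p.
  by have np : (n <= p)%N; [near: p; exact: nbhs_infty_ge|rewrite -(subnKC np); exact: step].
exists g, (limn m); split=> //.
apply: (@uniform_cvg_within_continuous _ _ _ _ u) => // e e0.
near=> n => t Kt; rewrite distrC -(ltr_pM2l k0); apply: (le_lt_trans (g_le n t Kt)).
rewrite ltrBlDl; near: n; apply: (cvgr_lt _ m_cvg).
by rewrite ltrDl mulr_gt0.
Unshelve. all: by end_near. Qed.

(** * Almost critical points *)

Lemma cvg_const_eq (R : realType) (V : normedModType R) (f : nat -> V) (c x : V) :
  (forall n, f n = c) -> f @ \oo --> x -> x = c.
Proof.
move=> fc fx; have cx : f @ \oo --> c.
  by under eq_cvg do rewrite fc; exact: cvg_cst.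
exact: (cvg_unique _ fx cx).
Qed.

(** Precomposition with the retraction of the line onto [0, 1]. *)
Lemma segment_path_extension (R : realType) (E : topologicalType) (gam : R -> E) :
  {within `[0 : R, 1], continuous gam} ->
  exists2 g : R -> E, continuous g &
    (forall t, t \in `[0, 1] -> g t = gam t) /\
    (forall t, exists2 s, s \in `[0, 1] & g t = gam s).
Proof.
move=> /subspace_continuousP gamc.
pose clamp (t : R) := Num.max 0 (Num.min 1 t).
have clampI t : clamp t \in `[0, 1].
  by rewrite in_itv /= /clamp le_max lexx ge_max ler01 ge_min lexx.
have clamp_cont : continuous clamp.
  move=> t; apply: (@continuous_max _ _ (cst (0 : R)) (fun t : R => Num.min 1 t)).
    exact: cvg_cst.
  by apply: (@continuous_min _ _ (cst (1 : R)) (@id R)); [exact: cvg_cst|exact: cvg_id].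
exists (gam \o clamp); last first.
  split=> [t|t]; last by exists (clamp t).
  by rewrite in_itv /= => /andP[t0 t1]; rewrite /clamp /= min_r// max_r.
move=> t U /(gamc _ (clampI t)) gU.
have := clamp_cont t [set s | s \in `[0, 1] -> U (gam s)] gU.
by move=> tU; apply: (@filterS _ (nbhs t) _ _ _ _ tU) => s; apply; exact: clampI.
Qed.

(** Two choices make the order on paths complete.  The upper bound m is
    carried along with the path instead of the maximum of phi, so that it passes
    to the limit pointwise; and the endpoints are fixed, because the condition
    phi (g 1) < theta is not closed. *)
Lemma almost_critical_point (R : realType) (E : completeNormedModType R)
    (H : normedModType R)
    (dot : {dot H for idfun}) (norm_dot : forall x : H, `|x| = Num.sqrt (dot x x))
    (j : {linear E -> H}) (j_cont : continuous j)
    (theta : R) (Upsilon : set E) (phi : E -> R) (phi_C1 : C1 phi) (a e : R) :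
  (endpoint_sup phi (GammaM j theta Upsilon phi) < a%:E)%E ->
  minimax phi (GammaM j theta Upsilon phi) = a%:E -> 0 < e ->
  exists u, [/\ sphereM j u, `|phi u - a| < e & (norm_dM dot j phi u <= e%:E)%E].
Proof.
set Gam := GammaM j theta Upsilon phi => gap aE e0; apply: contrapT => none.
have slope u : sphereM j u -> `|phi u - a| < e -> (e%:E < norm_dM dot j phi u)%E.
  by move=> Mu ua; rewrite ltNge; apply/negP => ?; apply: none; exists u.
have phi_cont : continuous phi.
  by move=> x; apply: differentiable_continuous; case: phi_C1.
have a_le g m : Gam g -> (forall t, t \in `[0, 1] -> phi (g t) <= m) -> a <= m.
  move=> Gg gm; rewrite -lee_fin -aE.
  apply: (le_trans (ereal_inf_lbound (ex_intro2 _ _ g Gg erefl))).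
  by apply: ge_ereal_sup => _ [t t01 <-]; rewrite lee_fin; exact: gm.
have [g0 [Gg0 g0m]] : exists g0, Gam g0 /\
    forall t, t \in `[0, 1] -> phi (g0 t) <= a + e / 2.
  have : (minimax phi Gam < (a + e / 2)%:E)%E.
    by rewrite aE lte_fin ltrDl divr_gt0.
  move=> /ereal_inf_lt[_ [g0 Gg0 <-]] /ltW g0m; exists g0; split=> // t t01.
  rewrite -lee_fin; apply: le_trans g0m; apply: ereal_sup_ubound.
  by exists t.
pose b := Num.max (phi (g0 0)) (phi (g0 1)).
have ba : b < a.
  rewrite -lte_fin; apply: le_lt_trans gap; apply: ereal_sup_ubound.
  by exists g0.
pose P (p : (R -> E) * R) := [/\ Gam p.1, p.1 0 = g0 0, p.1 1 = g0 1 &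
  forall t, t \in `[0, 1] -> phi (p.1 t) <= p.2].
pose below (q p : {p | P p}) := forall t, t \in `[0, 1] ->
  e / 2 * `|(sval p).1 t - (sval q).1 t| <= (sval p).2 - (sval q).2.
have I0 : (0 : R) \in `[0, 1] by rewrite in_itv /= lexx ler01.
have I1 : (1 : R) \in `[0, 1] by rewrite in_itv /= lexx ler01.
have e20 : 0 < e / 2 by rewrite divr_gt0.
have below_le q p : below q p -> (sval q).2 <= (sval p).2.
  move=> /(_ 0 I0) qp; rewrite -subr_ge0; apply: le_trans qp.
  by rewrite mulr_ge0 ?normr_ge0// ltW.
have Pg0 : P (g0, a + e / 2) by split.
have [|||||[[g m] gP] gle gmin] := @ordering_principle _ _ below (fun p => (sval p).2) a
  _ _ _ _ _ (exist _ _ Pg0).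
- by move=> p t _; rewrite !subrr normr0 mulr0.
- move=> p q r qp pr t t01; have := qp t t01; have := pr t t01.
  have := ler_distD ((sval p).1 t) ((sval r).1 t) ((sval q).1 t).
  by move=> /(ler_wpM2l (ltW e20)); rewrite mulrDr; lra.
- by move=> p q; exact: below_le.
- move=> p; case: (svalP p) => Gh _ _ hm; exact: (a_le _ _ Gh hm).
- move=> u uS.
  have uP n : P (sval (u n)) by case: (u n).
  have [g [l [gc ml ug ugl]]] := @controlled_sequence_limit _ _ _ `[(0 : R), 1]%classic
    (fun n => (sval (u n)).1) (fun n => (sval (u n)).2) (e / 2) a e20
    (fun n => let: And4 Gn _ _ mn := uP n in a_le _ _ Gn mn)
    (fun n => below_le _ _ (uS n))
    (fun n => let: And4 (And4 cn _ _ _) _ _ _ := uP n in cn)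
    uS.
  have g_0 : g 0 = g0 0 by apply: (cvg_const_eq _ (ug 0 I0)) => n; case: (uP n).
  have g_1 : g 1 = g0 1 by apply: (cvg_const_eq _ (ug 1 I1)) => n; case: (uP n).
  have Pg : P (g, l).
    case: Gg0 => _ _ Ug0 g0t; split=> //=; first split=> //; rewrite ?g_0 ?g_1//.
    + move=> t t01; apply: (@cvg_const_eq R R^o (fun n => `|j ((sval (u n)).1 t)|)).
        by move=> n; case: (uP n) => -[_ ->].
      apply: cvg_norm; apply: continuous_cvg; [exact: j_cont|exact: ug].
    + move=> t t01.
      apply: (ler_cvg_to _ ml (f := fun n => phi ((sval (u n)).1 t))).
        by apply: continuous_cvg; [exact: phi_cont|exact: ug].
      by apply: nearW => n; case: (uP n) => _ _ _; exact.
  by exists (exist _ _ Pg) => n t t01; exact: ugl.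
case: (gP) => /= Gg gg0 gg1 gm.
have am : a <= m by exact: (a_le _ _ Gg gm).
have me : m <= a + e / 2 by exact: (below_le _ _ gle).
case: (Gg) => gc gM Ug gt.
have [g' g'_cont [g'E g'R]] := segment_path_extension gc.
have g'M t : sphereM j (g' t) by have [s s01 ->] := g'R t; exact: gM.
have [h [eta [h0 etaP]]] : exists (h : R) (eta : R -> E), 0 < h /\
    forall t, `[0, 1]%classic t ->
    [/\ {for t, continuous eta}, sphereM j (eta t),
        `|g' t - eta t| <= 2 * h, phi (eta t) <= m - e * h &
        phi (g' t) <= b -> eta t = g' t].
  apply: (@deformation _ _ _ _ norm_dot _ j_cont R^o _ phi_C1) => //.
  - exact: segment_compact.
  - exact: lt_le_trans am.
  - by move=> t t01; rewrite g'E//; exact: gm.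
  - move=> t t01 mt; apply: slope => //.
    have := gm t t01; rewrite -g'E// => tm.
    by rewrite ger0_norm; lra.
have eta0 : eta 0 = g0 0.
  have [_ _ _ _ ->] := etaP 0 I0; first by rewrite g'E.
  by rewrite g'E// gg0 /b le_max lexx.
have eta1 : eta 1 = g0 1.
  have [_ _ _ _ ->] := etaP 1 I1; first by rewrite g'E.
  by rewrite g'E// gg1 /b le_max lexx orbT.
have Peta : P (eta, m - e * h).
  split=> //=; last by move=> t t01; have [] := etaP t t01.
  split; rewrite ?eta0 ?eta1 -?gg0 -?gg1//.
  - by apply: continuous_in_subspaceT => t /set_mem t01; have [] := etaP t t01.
  - by move=> t t01; have [] := etaP t t01.
have := gmin (exist _ _ Peta); rewrite /below /= => /(_ _)/wrap[].
  move=> t t01; have [_ _ + _ _] := etaP t t01; rewrite g'E// => d.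
  have := ler_wpM2l (ltW e20) d; lra.
by apply/negP; rewrite -ltNge ltrBlDr ltrDl mulr_gt0.
Qed.

(** The supremum is over a nonempty set: if 0 were the only tangent vector at u,
    every v would equal its radial part (j u, j v) u and E would be a line. *)
Lemma norm_dM_ge0 (R : realType) (E H : normedModType R)
    (dot : {dot H for idfun}) (norm_dot : forall x : H, `|x| = Num.sqrt (dot x x))
    (dimE : infinite_dimensional E) (j : {linear E -> H}) (phi : E -> R) (u : E) :
  sphereM j u -> (0 <= norm_dM dot j phi u)%E.
Proof.
move=> Mu; have [v uv v0] : exists2 v, tangent dot j u v & v != 0.
  apply: contrapT => none; apply: dimE; exists 1%N, (fun _ => u) => v.
  exists (fun _ => dot (j u) (j v)); rewrite big_ord1; apply/eqP.
  rewrite -subr_eq0; apply/negPn/negP => nz; apply: none.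
  exists (tangent_proj dot j u v) => //.
  exact: tangent_tangent_proj.
apply: (@le_trans _ _ (`|'d phi u (`|v|^-1 *: v)|)%:E); first by rewrite lee_fin.
apply: ereal_sup_ubound; exists (`|v|^-1 *: v) => //; split.
  by rewrite /tangent /= linearZ/= dotZr uv mulr0.
by rewrite normrZ normfV normr_id mulVf// normr_eq0.
Qed.

Lemma minimax_fin_num (R : realType) (E : normedModType R) (phi : E -> R)
    (G : set (R -> E)) :
  continuous phi -> G !=set0 ->
  (forall g, G g -> {within `[0 : R, 1], continuous g}) ->
  (endpoint_sup phi G < minimax phi G)%E -> minimax phi G \is a fin_num.
Proof.
move=> phi_cont [g Gg] Gcont gap.
have gc : {within `[0 : R, 1], continuous (phi \o g)}.
  by apply: within_continuous_comp; [move=> x _; exact: phi_cont|exact: Gcont].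
have [c c01 cmax] := EVT_max ler01 gc.
rewrite fin_numE; apply/andP; split.
  by apply/eqP => GNy; move: gap; rewrite GNy ltNge leNye.
apply/eqP => Gy.
have : (minimax phi G <= (phi (g c))%:E)%E.
  apply: (le_trans (ereal_inf_lbound (ex_intro2 _ _ g Gg erefl))).
  by apply: ge_ereal_sup => _ [t t01 <-]; rewrite lee_fin; exact: cmax.
by rewrite Gy leNgt ltry.
Qed.

(** * The minimax principle *)

Theorem corollary2p6 (R : realType) (E H : completeNormedModType R)
    (dot : {dot H for idfun})
    (norm_dot : forall x : H, `|x| = Num.sqrt (dot x x))
    (dimE : infinite_dimensional E) (dimH : infinite_dimensional H)
    (j : {linear E -> H})
    (j_cont : continuous j) (j_inj : injective j)
    (dual_cont : continuous_to_dual (to_dual dot j))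
    (dual_inj : injective (to_dual dot j))
    (theta : R) (Upsilon : set E) (Upsilon_sub : Upsilon `<=` sphereM j)
    (phi : E -> R) (phi_C1 : C1 phi)
    (Gamma_neq0 : GammaM j theta Upsilon phi !=set0)
    (gap : (endpoint_sup phi (GammaM j theta Upsilon phi)
            < minimax phi (GammaM j theta Upsilon phi))%E) :
  exists u : nat -> E,
    [/\ forall n, sphereM j (u n),
        (phi (u n))%:E @[n --> \oo] --> minimax phi (GammaM j theta Upsilon phi) &
        norm_dM dot j phi (u n) @[n --> \oo] --> 0%E].
Proof.
have phi_cont : continuous phi.
  by move=> x; apply: differentiable_continuous; case: phi_C1.
have afin : minimax phi (GammaM j theta Upsilon phi) \is a fin_num.
  by apply: minimax_fin_num => // g [].
pose a := fine (minimax phi (GammaM j theta Upsilon phi)).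
have aE : minimax phi (GammaM j theta Upsilon phi) = a%:E by rewrite fineK.
rewrite aE in gap *.
have ex n : exists u, [/\ sphereM j u, `|phi u - a| < harmonic n &
    (norm_dM dot j phi u <= (harmonic n)%:E)%E].
  by apply: almost_critical_point aE _ => //; rewrite /harmonic invr_gt0.
have [u uP] := choice ex; exists u; split=> [n||].
- by have [] := uP n.
- apply: cvg_EFin; first by apply: nearW.
  apply/cvgrPdist_lt => e e0; near=> n.
  rewrite distrC; apply: lt_trans (_ : harmonic n < e); first by have [] := uP n.
  by near: n; apply: (cvgr_lt 0) => //; exact: cvg_harmonic.
- apply: (@squeeze_cvge _ _ _ _ (cst 0%E) _ (fun n => (harmonic n)%:E)).
  + apply: nearW => n; have [Mn _ ->] := uP n.
    by rewrite andbT; exact: (norm_dM_ge0 norm_dot).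
  + exact: cvg_cst.
  + by apply: cvg_EFin; [exact: nearW|exact: cvg_harmonic].
Unshelve. all: by end_near. Qed.
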